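(* Let $x_{N\mathrm{eff}}(t)$ be the solution of the one-dimensional reduced equation for the finite network, $$\frac{dx_{N\mathrm{eff}}}{dt}=f(x_{N\mathrm{eff}})+\beta_{N\mathrm{eff}}\,G(x_{N\mathrm{eff}},x_{N\mathrm{eff}}),$$ and let $x_{\mathrm{eff}}(t)$ be the solution of the one-dimensional reduced equation for the graphon dynamical system, $$\frac{dx_{\mathrm{eff}}}{dt}=f(x_{\mathrm{eff}})+\beta_{\mathrm{eff}}\,G(x_{\mathrm{eff}},x_{\mathrm{eff}}).$$ Assume that the initial conditions satisfy $\lim_{N\to\infty}|x_{N\mathrm{eff}}(0)-x_{\mathrm{eff}}(0)|=0$. Then, for any fixed $T>0$, $$\lim_{N\to\infty}\max_{t\in[0,T]}|x_{N\mathrm{eff}}(t)-x_{\mathrm{eff}}(t)|=0.$$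
   Context: $I=[0,1]$; $I_{N,i}=[\frac{i-1}{N},\frac iN)$ for $1\le i\le N-1$ and $I_{N,N}=[\frac{N-1}{N},1]$. A graphon is a symmetric measurable function $W:I^2\to[0,1]$; here $W$ is a graphon that is continuous at almost every point of $I^2$ and $\int_0^1\int_0^1W\,\mathrm{d}y\,\mathrm{d}y'>0$. The step graphon $W_N$ is $W_N(y,y')=N^2\int_{I_{N,i}\times I_{N,j}}W(z,z')\,\mathrm{d}z\,\mathrm{d}z'$ for $(y,y')\in I_{N,i}\times I_{N,j}$. Weighted degrees: $s(y)=\int_0^1W(y,y')\,\mathrm{d}y'$ and $s_N(y)=\int_0^1W_N(y,y')\,\mathrm{d}y'$. The effective coupling constants are $$\beta_{\mathrm{eff}}=\frac{\int_0^1s(y)^2\,\mathrm{d}y}{\int_0^1s(y)\,\mathrm{d}y},\qquad \beta_{N\mathrm{eff}}=\frac{\int_0^1s_N(y)^2\,\mathrm{d}y}{\int_0^1s_N(y)\,\mathrm{d}y}.$$ $\Omega\subset\mathbb R$ is a bounded closed interval; $f:\Omega\to\mathbb R$ satisfies $|f(x)-f(x')|\le L_f|x-x'|$ on $\Omega$; $G:\Omega\times\Omega\to\mathbb R$ satisfies $|G(u,v)-G(u',v')|\le L_G\|(u,v)-(u',v')\|_2$ on $\Omega\times\Omega$. The solutions $x_{N\mathrm{eff}}$ and $x_{\mathrm{eff}}$ are defined for all $t\ge0$ and take values in $\Omega$, so that $f$ and $G$ are evaluated only on their domains. *)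

(* Defs.v *)
From HB Require Import structures.
From mathcomp Require Import all_boot all_order all_algebra.
From mathcomp Require Import all_classical all_reals all_analysis.
From mathcomp Require Import measurable_realfun.
Set Implicit Arguments.
Unset Strict Implicit.
Unset Printing Implicit Defensive.
Import Order.TTheory GRing.Theory Num.Theory.
Import numFieldNormedType.Exports.
Local Open Scope classical_set_scope.
Local Open Scope ring_scope.

Notation leb1 R := (@lebesgue_measure R).
Notation leb2 R := (@lebesgue_measure R \x @lebesgue_measure R)%E.

Definition unit_itv (R : realType) : set R := `[0, 1].
Arguments unit_itv R : clear implicits.

Definition unit_square (R : realType) : set (R * R) :=
  unit_itv R `*` unit_itv R.
Arguments unit_square R : clear implicits.

(* A kernel is a function on the whole plane of which only the values on the
   unit square matter. Its measurability is Lebesgue measurability: preimages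
   of Borel sets are Borel sets up to a null set. *)
Definition graphon (R : realType) (W : R * R -> R) : Prop :=
  [/\ forall y y', unit_itv R y -> unit_itv R y' -> W (y, y') = W (y', y),
      forall B : set (measurableTypeR R), measurable B ->
        completed_algebra_gen (leb2 R) (unit_square R `&` W @^-1` B) &
      forall p, unit_square R p -> 0 <= W p <= 1].

(* Continuity at a point of the square is relative to the square. *)
Definition ae_continuous_square (R : realType) (W : R * R -> R) : Prop :=
  {ae leb2 R, forall p : R * R, unit_square R p ->
     W q @[q --> within (unit_square R) (nbhs p)] --> W p}.

(* The measures leb1 and leb2 live on the Borel sets. The integral
   of a nonnegative function is the supremum of the integrals of the simple
   functions below it; hence it still is the Lebesgue integral when the
   function is only measurable for the completed measure. *)
Definition degree (R : realType) (W : R * R -> R) (y : R) : R :=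
  (\int[leb1 R]_(y' in unit_itv R) W (y, y'))%R.

Definition beta_eff (R : realType) (W : R * R -> R) : R :=
  (\int[leb1 R]_(y in unit_itv R) (degree W y ^+ 2))%R /
  (\int[leb1 R]_(y in unit_itv R) degree W y)%R.

(* The cells of level N are numbered i = 1, ..., N; the last one is closed. *)
Definition cell (R : realType) (N i : nat) : set R :=
  if i == N then `[i.-1%:R / N%:R, i%:R / N%:R]%classic
  else `[i.-1%:R / N%:R, i%:R / N%:R[%classic.
Arguments cell R N i : clear implicits.

Definition cell_average (R : realType) (W : R * R -> R) (N i j : nat) : R :=
  N%:R ^+ 2 * (\int[leb2 R]_(z in cell R N i `*` cell R N j) W z)%R.

(* For 0 < N the cells partition the unit interval, so that at a point of the
   square exactly one term of the sum is not multiplied by 0. *)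
Definition step_graphon (R : realType) (W : R * R -> R) (N : nat)
    (p : R * R) : R :=
  \sum_(1 <= i < N.+1) \sum_(1 <= j < N.+1)
    cell_average W N i j * \1_(cell R N i `*` cell R N j) p.

Definition lipschitz1 (R : realType) (a b L : R) (f : R -> R) : Prop :=
  forall x x', x \in `[a, b] -> x' \in `[a, b] ->
    `|f x - f x'| <= L * `|x - x'|.

(* The norm of the library on R * R is the max norm. *)
Definition lipschitz2 (R : realType) (a b L : R) (G : R -> R -> R) : Prop :=
  forall u v u' v', u \in `[a, b] -> v \in `[a, b] ->
    u' \in `[a, b] -> v' \in `[a, b] ->
    `|G u v - G u' v'| <= L * Num.sqrt ((u - u') ^+ 2 + (v - v') ^+ 2).

(* The solution lives on [0, +oo[: the derivative is two-sided for t > 0 and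
   one-sided at t = 0. *)
Definition reduced_solution (R : realType) (a b : R) (f : R -> R)
    (G : R -> R -> R) (beta : R) (x : R -> R) : Prop :=
  forall t : R, 0 <= t ->
    x t \in `[a, b] /\
    h^-1 * (x (h + t) - x t) @[h --> within [set h | 0 <= h + t] 0^']
      --> f (x t) + beta * G (x t) (x t).

Definition is_maximum (R : realType) (A : set R) (m : R) : Prop :=
  A m /\ ubound A m.

(* Main.v *)
Require Import Defs.
From HB Require Import structures.
From mathcomp Require Import all_boot all_order all_algebra.
From mathcomp Require Import all_classical all_reals all_analysis.
From mathcomp Require Import ring lra measurable_realfun.
Import Order.TTheory GRing.Theory Num.Theory.
Import numFieldNormedType.Exports.
Local Open Scope classical_set_scope.
Local Open Scope ring_scope.

Set Implicit Arguments.
Unset Strict Implicit.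
Unset Printing Implicit Defensive.

(** The two reduced equations differ only in their coupling constants and
    initial values, so the claim splits into the convergence
    beta_eff (step_graphon W N) -> beta_eff W ([beta_eff_cvg]) and the
    continuous dependence of a scalar Lipschitz equation on its coupling
    constant and initial value ([reduced_solution_close]).

    Convergence of the coupling constants. A bounded kernel that is continuous
    almost everywhere is Riemann integrable. On each product of two cells of
    level N, both W and its step graphon, a cell average of W, lie between the
    infimum and the supremum of W there. Integrating first in one variable and
    then in the other, the mean degrees of the two kernels lie in a common
    interval, and so do the means of their squared degrees; the lengths of
    these intervals are bounded by the mean oscillation of W over the products
    of cells, respectively by twice that ([degree_moments_close]). The
    oscillation over the product of cells around p tends to 0 at every point p
    of continuity, because the cells shrink, and it is at most 1; by dominated
    convergence the mean oscillation tends to 0 ([osc_mean_cvg]). Since W has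
    positive mean, the quotients converge. Only step functions are ever
    integrated exactly: W and its sections, which need not be Borel, enter
    through the monotonicity of the integral ([le_lower_integral]).

    Continuous dependence. The difference u of two solutions satisfies
    |u'| <= K |u| + d, where d is proportional to the difference of the
    coupling constants. As |u| is not differentiable at its zeros, Gronwall's
    inequality is applied to u ^ 2. The resulting bound is uniform on [0, T],
    so it controls the maximum, which exists by continuity. *)

(** * The cells of the unit interval *)

(** With [cell_inj] below: for 0 < N the cells partition the unit interval. *)
Lemma cell_cover (R : realType) (N : nat) (y : R) :
  (0 < N)%N -> unit_itv R y ->
  exists i, (1 <= i < N.+1)%N /\ cell R N i y.
Proof.
move=> N0; rewrite /unit_itv/= in_itv/= => /andP[y0 y1].
have N0R : 0 < N%:R :> R by rewrite ltr0n.
have Ny0 : 0 <= y * N%:R by rewrite mulr_ge0// ler0n.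
(* The end point 1 belongs to the last cell, which is closed; any other y to
   the cell whose index is one more than the integer part of y * N. *)
have [y1'|y1'] := ltP y 1; last first.
  have -> : y = 1 by apply/le_anti; rewrite y1 y1'.
  exists N; split; first by rewrite N0 ltnS leqnn.
  rewrite /cell eqxx/= in_itv/= divff ?gt_eqF// lexx andbT.
  by rewrite ler_pdivrMr// mul1r ler_nat leq_pred.
have /andP[t1 t2] := Num.Theory.truncn_itv Ny0.
have tN : (Num.truncn (y * N%:R) < N)%N.
  by rewrite -(ltr_nat R) (le_lt_trans t1)// gtr_pMl.
exists (Num.truncn (y * N%:R)).+1; split; first by rewrite /= ltnS.
rewrite /cell /=; case: ifPn => _ /=; rewrite in_itv/= ler_pdivrMr// t1/=.
  by rewrite ler_pdivlMr// ltW.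
by rewrite ltr_pdivlMr.
Qed.

Lemma cell_bounds (R : realType) (N i : nat) (y : R) :
  cell R N i y -> i.-1%:R / N%:R <= y <= i%:R / N%:R.
Proof.
rewrite /cell; case: ifPn => _ /=; rewrite in_itv//= => /andP[-> /ltW ->//].
Qed.

Lemma cell_unit (R : realType) (N i : nat) (y : R) :
  (1 <= i < N.+1)%N -> cell R N i y -> unit_itv R y.
Proof.
move=> /andP[i0 iN] cy; have N0 : (0 < N)%N by exact: leq_trans i0 _.
have /andP[y1 y2] := cell_bounds cy.
rewrite /unit_itv/= in_itv/= (le_trans _ y1) ?divr_ge0//=.
by apply: (le_trans y2); rewrite ler_pdivrMr ?ltr0n// mul1r ler_nat.
Qed.

Lemma cell_inj (R : realType) (N i j : nat) (y : R) :
  (1 <= i < N.+1)%N -> (1 <= j < N.+1)%N ->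
  cell R N i y -> cell R N j y -> i = j.
Proof.
wlog ij : i j / (i <= j)%N.
  move=> h hi hj ci cj; have /orP[?|?] := leq_total i j; first exact: h.
  by apply/esym; exact: h.
move=> /andP[i0 iN] /andP[j0 jN] ci cj; apply/eqP; rewrite eqn_leq ij/=.
rewrite leqNgt; apply/negP => ij'.
have N0 : (0 < N)%N by exact: leq_trans i0 _.
have N0R : 0 < N%:R :> R by rewrite ltr0n.
have iN' : i == N = false by apply/ltn_eqF/(leq_trans ij').
have /andP[y1 _] := cell_bounds cj.
move: ci; rewrite /cell iN'/= in_itv/= => /andP[_ yi].
have := le_lt_trans y1 yi; rewrite ltr_pM2r ?invr_gt0// ltr_nat.
by rewrite ltnNge -ltnS prednK// ij'.
Qed.

Lemma cell_width (R : realType) (N i : nat) : (0 < i)%N ->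
  i%:R / N%:R - i.-1%:R / N%:R = N%:R^-1 :> R.
Proof.
by move=> i0; rewrite -mulrBl -natrB ?leq_pred// -subn1 subKn// mul1r.
Qed.

Lemma cell_left_end (R : realType) (N i : nat) :
  (1 <= i < N.+1)%N -> cell R N i (i.-1%:R / N%:R).
Proof.
move=> /andP[i0 iN]; have N0 : (0 < N)%N by exact: leq_trans i0 _.
rewrite /cell; case: ifPn => _ /=; rewrite in_itv/= lexx/=.
  by rewrite ler_wpM2r ?invr_ge0// ler_nat leq_pred.
by rewrite ltr_pM2r ?invr_gt0 ?ltr0n// ltr_nat prednK.
Qed.

Lemma measurable_cell (R : realType) (N i : nat) :
  measurable (cell R N i : set (measurableTypeR R)).
Proof. by rewrite /cell; case: ifPn => _; exact: measurable_itv. Qed.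

Lemma lebesgue_measure_cell (R : realType) (N i : nat) :
  (1 <= i < N.+1)%N -> leb1 R (cell R N i) = (N%:R^-1)%:E.
Proof.
move=> /andP[i0 iN]; have N0R : 0 < N%:R :> R.
  by rewrite ltr0n (leq_trans i0).
have h : i.-1%:R / N%:R < i%:R / N%:R :> R.
  by rewrite ltr_pM2r ?invr_gt0// ltr_nat prednK.
by rewrite /cell; case: ifPn => _; rewrite lebesgue_measure_itv/= lte_fin h
  -EFinB cell_width.
Qed.

Lemma cell_close (R : realType) (N i : nat) (y y' : R) :
  (1 <= i < N.+1)%N -> cell R N i y -> cell R N i y' -> `|y - y'| <= N%:R^-1.
Proof.
move=> /andP[i0 _] cy cy'.
have /andP[a1 a2] := cell_bounds cy; have /andP[b1 b2] := cell_bounds cy'.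
by rewrite -(cell_width R N i0) ler_norml; apply/andP; split; lra.
Qed.

Lemma cell_step (R : realType) (N i : nat) (A : nat -> R) (y : R) :
  (1 <= i < N.+1)%N -> cell R N i y ->
  \sum_(1 <= k < N.+1) A k * \1_(cell R N k) y = A i.
Proof.
move=> hi ci; rewrite (bigD1_seq i) ?mem_index_iota ?iota_uniq//=.
rewrite indicE mem_set// mulr1 big_seq_cond big1 ?addr0// => k.
rewrite mem_index_iota => /andP[hk ki]; rewrite indicE memNset ?mulr0// => ck.
by move/eqP: ki; apply; exact: cell_inj ck ci.
Qed.

Lemma cell_step2 (R : realType) (N i j : nat) (A : nat -> nat -> R)
    (p : R * R) :
  (1 <= i < N.+1)%N -> (1 <= j < N.+1)%N ->
  cell R N i p.1 -> cell R N j p.2 ->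
  \sum_(1 <= k < N.+1) \sum_(1 <= l < N.+1)
     A k l * \1_(cell R N k `*` cell R N l) p = A i j.
Proof.
move=> hi hj ci cj; rewrite -(cell_step (A ^~ j) hi ci); apply: eq_bigr => k _.
rewrite -(cell_step (A k) hj cj) mulr_suml; apply: eq_bigr => l _.
by rewrite -mulrA !indicE in_setX -natrM mulnb andbC.
Qed.

(** * Integrals of functions between two step functions *)

(** The integral of a nonnegative function is the supremum of the integrals of
    the simple functions below it, and those below f are below g. This covers
    the kernels and sections that are only measurable for the completed
    measure. *)
Lemma le_lower_integral d (T : measurableType d) (R : realType)
    (mu : {measure set T -> \bar R}) (D : set T) (f g : T -> R) :
  (forall x, D x -> 0 <= f x) -> (forall x, D x -> f x <= g x) ->
  (\int[mu]_(x in D) (f x)%:E <= \int[mu]_(x in D) (g x)%:E)%E.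
Proof.
move=> f0 fg.
have g0 x : D x -> 0 <= g x by move=> Dx; exact: le_trans (f0 x Dx) (fg x Dx).
rewrite !ge0_integralE//; do ?by move=> x Dx; rewrite lee_fin; auto.
apply: le_ereal_sup => _ [h hf <-]; exists h => // x.
apply: (le_trans (hf x)); rewrite !patchE; case: ifPn => // /set_mem Dx.
by rewrite lee_fin fg.
Qed.

Lemma fine_between (R : realType) (m M : R) (z : \bar R) :
  (m%:E <= z)%E -> (z <= M%:E)%E -> m <= fine z <= M.
Proof. by case: z => [r| |]//=; rewrite !lee_fin => -> ->. Qed.

(** The workhorse of both integrations, in y' for a degree and in y for the
    moments of the degrees: g is squeezed between two step functions, whose
    integrals are explicit. *)
Lemma Rintegral_cell (R : realType) (N : nat) (A B : nat -> R) (g : R -> R) :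
  (0 < N)%N -> (forall i, (1 <= i < N.+1)%N -> 0 <= A i) ->
  (forall i y, (1 <= i < N.+1)%N -> cell R N i y -> A i <= g y <= B i) ->
  (\sum_(1 <= i < N.+1) A i) / N%:R <= (\int[leb1 R]_(y in unit_itv R) g y)%R
    <= (\sum_(1 <= i < N.+1) B i) / N%:R.
Proof.
move=> N0 A0 gAB.
have step (C : nat -> R) : (forall i, (1 <= i < N.+1)%N -> 0 <= C i) ->
    (\int[leb1 R]_(y in unit_itv R)
      (\sum_(1 <= k < N.+1) C k * \1_(cell R N k) y)%:E)%E
    = ((\sum_(1 <= i < N.+1) C i) / N%:R)%:E.
  (* The absolute values only make the coefficients nonnegative for all
     indices, including those outside 1, ..., N. *)
  move=> C0; pose C' (i : nat) : R := `|C i|.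
  transitivity (\int[leb1 R]_(y in unit_itv R)
      (\sum_(k <- index_iota 1 N.+1) (C' k * \1_(cell R N k) y)%:E))%E.
    apply: eq_integral => y _; rewrite sumEFin; congr EFin.
    apply: eq_big_seq => i; rewrite mem_index_iota => hi.
    by rewrite /C' ger0_norm// C0.
  rewrite ge0_integral_sum//=; first last.
  - by move=> n x _; rewrite lee_fin mulr_ge0// /C'.
  - move=> n; apply/measurable_EFinP; apply: measurable_funM => //.
    by apply: measurable_indic; exact: measurable_cell.
  - exact: measurable_itv.
  rewrite mulr_suml -sumEFin; apply: eq_big_seq => i.
  rewrite mem_index_iota => hi.
  under eq_integral do rewrite EFinM.
  rewrite ge0_integralZl_EFin//; first last.
  - exact: normr_ge0.
  - by apply/measurable_EFinP; apply: measurable_indic; exact: measurable_cell.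
  - exact: measurable_itv.
  rewrite integral_indic//; [|exact: measurable_itv|exact: measurable_cell].
  rewrite setIidl; last by move=> y; exact: cell_unit.
  by rewrite [X in (_ * X)%E](lebesgue_measure_cell R hi) /C' ger0_norm// C0.
have B0 i : (1 <= i < N.+1)%N -> 0 <= B i.
  move=> hi; have /andP[u v] := gAB _ _ hi (cell_left_end R hi).
  exact: le_trans (A0 _ hi) (le_trans u v).
rewrite /Rintegral.
apply: fine_between; rewrite -step//; apply: le_lower_integral.
- move=> y _; rewrite big_seq sumr_ge0// => i; rewrite mem_index_iota => hi.
  by rewrite mulr_ge0// A0.
- move=> y /(cell_cover N0)[i [hi ci]]; rewrite (cell_step A hi ci).
  by have /andP[] := gAB _ _ hi ci.
- move=> y /(cell_cover N0)[i [hi ci]]; have /andP[+ _] := gAB _ _ hi ci.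
  by apply: le_trans; exact: A0.
- move=> y /(cell_cover N0)[i [hi ci]]; rewrite (cell_step B hi ci).
  by have /andP[] := gAB _ _ hi ci.
Qed.

(** * Oscillation of a kernel over products of cells *)

Definition lower_cell (R : realType) (W : R * R -> R) (N i j : nat) : R :=
  inf [set W p | p in cell R N i `*` cell R N j].

Definition upper_cell (R : realType) (W : R * R -> R) (N i j : nat) : R :=
  sup [set W p | p in cell R N i `*` cell R N j].

(** The difference between the upper and lower Darboux sums of W. *)
Definition osc_mean (R : realType) (W : R * R -> R) (N : nat) : R :=
  (\sum_(1 <= i < N.+1) \sum_(1 <= j < N.+1)
     (upper_cell W N i j - lower_cell W N i j)) / N%:R ^+ 2.

(** The property shared by W and its step graphon through which their degrees
    are compared. *)
Definition between_cells (R : realType) (W K : R * R -> R) (N : nat) : Prop :=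
  forall i j p, (1 <= i < N.+1)%N -> (1 <= j < N.+1)%N ->
    (cell R N i `*` cell R N j) p ->
    lower_cell W N i j <= K p <= upper_cell W N i j.

Section square.
Variables (R : realType) (W : R * R -> R).
Hypothesis W01 : forall p, unit_square R p -> 0 <= W p <= 1.

Lemma cells_square (N i j : nat) (p : R * R) :
  (1 <= i < N.+1)%N -> (1 <= j < N.+1)%N ->
  (cell R N i `*` cell R N j) p -> unit_square R p.
Proof.
move=> hi hj [/= ci cj].
by split; [exact: cell_unit hi ci|exact: cell_unit hj cj].
Qed.

Lemma between_cells_self (N : nat) : between_cells W W N.
Proof.
move=> i j p hi hj cp; apply/andP; split.
  apply: ge_inf; last by exists p.
  by exists 0 => _ [q /(cells_square hi hj)/W01/andP[? _] <-].
apply: ub_le_sup; last by exists p.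
by exists 1 => _ [q /(cells_square hi hj)/W01/andP[_ ?] <-].
Qed.

Lemma extrema_cell (N i j : nat) : (1 <= i < N.+1)%N -> (1 <= j < N.+1)%N ->
  [/\ 0 <= lower_cell W N i j, lower_cell W N i j <= upper_cell W N i j
    & upper_cell W N i j <= 1].
Proof.
move=> hi hj.
pose p : R * R := (i.-1%:R / N%:R, j.-1%:R / N%:R).
have cp : (cell R N i `*` cell R N j) p by split; exact: cell_left_end.
split.
- apply: lb_le_inf; first by exists (W p), p.
  by move=> _ [q /(cells_square hi hj)/W01/andP[? _] <-].
- by have /andP[] := between_cells_self hi hj cp; exact: le_trans.
- apply: ge_sup; first by exists (W p), p.
  by move=> _ [q /(cells_square hi hj)/W01/andP[_ ?] <-].
Qed.

Lemma measurable_cells (N i j : nat) :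
  measurable (cell R N i `*` cell R N j
    : set (measurableTypeR R * measurableTypeR R)).
Proof. by apply: measurableX; exact: measurable_cell. Qed.

Lemma measurable_unit_square :
  measurable (unit_square R : set (measurableTypeR R * measurableTypeR R)).
Proof. by apply: measurableX; exact: measurable_itv. Qed.

Lemma lebesgue_measure_cells (N i j : nat) :
  (1 <= i < N.+1)%N -> (1 <= j < N.+1)%N ->
  leb2 R (cell R N i `*` cell R N j) = ((N%:R ^+ 2)^-1)%:E.
Proof.
move=> hi hj; rewrite product_measure1E; [|exact: measurable_cell..].
rewrite [X in (X * _)%E](lebesgue_measure_cell R hi).
rewrite [X in (_ * X)%E](lebesgue_measure_cell R hj).
by rewrite -EFinM -invfM expr2.
Qed.

(** An average of W over a product of cells lies between its extrema there. *)
Lemma between_cells_step (N : nat) : between_cells W (step_graphon W N) N.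
Proof.
move=> i j p hi hj [/= c1 c2].
rewrite /step_graphon (cell_step2 _ hi hj c1 c2) /cell_average.
have N0 : 0 < N%:R ^+ 2 :> R.
  by rewrite exprn_gt0// ltr0n; move: hi => /andP[i0 iN]; exact: leq_trans i0 _.
have [l0 lu u1] := extrema_cell hi hj.
rewrite [_ * Rintegral _ _ _]mulrC -ler_pdivrMr// -(ler_pdivlMr _ _ N0).
rewrite /Rintegral.
have cstE (c : R) : ((c / N%:R ^+ 2)%:E =
    \int[leb2 R]_(z in cell R N i `*` cell R N j) c%:E)%E.
  rewrite integral_cst; last exact: measurable_cells.
  by rewrite [X in (_ * X)%E](lebesgue_measure_cells hi hj).
by apply: fine_between; rewrite cstE; apply: le_lower_integral => q cq //;
  have /andP[? ?] := between_cells_self hi hj cq; lra.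
Qed.

(** Darboux sums in y' that serve for the sections of W at all points y of the
    i-th cell: the extrema are taken over both variables. *)
Definition lower_row (N i : nat) : R :=
  (\sum_(1 <= j < N.+1) lower_cell W N i j) / N%:R.

Definition upper_row (N i : nat) : R :=
  (\sum_(1 <= j < N.+1) upper_cell W N i j) / N%:R.

Lemma degree_between (K : R * R -> R) (N i : nat) (y : R) :
  between_cells W K N -> (1 <= i < N.+1)%N -> cell R N i y ->
  lower_row N i <= degree K y <= upper_row N i.
Proof.
move=> KW hi ci; apply: Rintegral_cell.
- by move: hi => /andP[i0 iN]; exact: leq_trans i0 _.
- by move=> j hj; have [] := extrema_cell hi hj.
- by move=> j y' hj cj; exact: KW.
Qed.

Lemma row_bounds (N i : nat) : (1 <= i < N.+1)%N ->
  [/\ 0 <= lower_row N i, lower_row N i <= upper_row N i & upper_row N i <= 1].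
Proof.
move=> hi; have N0 : 0 < N%:R :> R.
  by rewrite ltr0n; move: hi => /andP[i0 iN]; exact: leq_trans i0 _.
have H j : j \in index_iota 1 N.+1 -> _ :=
  fun hj => extrema_cell hi (etrans (esym (mem_index_iota _ _ _)) hj).
split.
- rewrite /lower_row divr_ge0 ?ler0n// big_seq sumr_ge0// => j hj.
  by have [] := H j hj.
- rewrite /lower_row /upper_row ler_wpM2r ?invr_ge0 ?ler0n//.
  rewrite big_seq [leRHS]big_seq.
  by apply: ler_sum => j hj; have [] := H j hj.
- rewrite /upper_row ler_pdivrMr// mul1r big_seq.
  apply: (@le_trans _ _ (\sum_(1 <= j < N.+1) 1)).
    by rewrite [leRHS]big_seq; apply: ler_sum => j hj; have [] := H j hj.
  by rewrite sumr_const_nat subn1.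
Qed.

Lemma osc_meanE (N : nat) :
  osc_mean W N = (\sum_(1 <= i < N.+1) (upper_row N i - lower_row N i)) / N%:R.
Proof.
rewrite /osc_mean expr2 invfM mulrA; congr (_ / _).
rewrite mulr_suml; apply: eq_bigr => i _.
by rewrite /upper_row /lower_row -mulrBl -sumrB.
Qed.

(** Both kernels have their moments in the same interval. For the second
    moments its length is bounded through B ^ 2 - A ^ 2 <= 2 (B - A), valid for
    0 <= A <= B <= 1. *)
Lemma degree_moments_close (K K' : R * R -> R) (N : nat) : (0 < N)%N ->
  between_cells W K N -> between_cells W K' N ->
  `|(\int[leb1 R]_(y in unit_itv R) degree K y)%R
    - (\int[leb1 R]_(y in unit_itv R) degree K' y)%R| <= osc_mean W N /\
  `|(\int[leb1 R]_(y in unit_itv R) (degree K y ^+ 2))%R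
    - (\int[leb1 R]_(y in unit_itv R) (degree K' y ^+ 2))%R|
    <= 2 * osc_mean W N.
Proof.
move=> N0 KW KW'.
have close (a b x x' c : R) : a <= x <= b -> a <= x' <= b -> b - a <= c ->
    `|x - x'| <= c.
  by move=> /andP[? ?] /andP[? ?] ?; rewrite ler_norml; lra.
have first H : between_cells W H N ->
    (\sum_(1 <= i < N.+1) lower_row N i) / N%:R <=
     (\int[leb1 R]_(y in unit_itv R) degree H y)%R
    <= (\sum_(1 <= i < N.+1) upper_row N i) / N%:R.
  move=> HW; apply: Rintegral_cell => //.
    by move=> i hi; have [] := row_bounds hi.
  by move=> i y hi ci; exact: degree_between.
have second H : between_cells W H N ->
    (\sum_(1 <= i < N.+1) lower_row N i ^+ 2) / N%:R <=
     (\int[leb1 R]_(y in unit_itv R) (degree H y ^+ 2))%R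
    <= (\sum_(1 <= i < N.+1) upper_row N i ^+ 2) / N%:R.
  move=> HW; apply: Rintegral_cell => //.
    by move=> i hi; exact: sqr_ge0.
  move=> i y hi ci; have [? ? ?] := row_bounds hi.
  have /andP[? ?] := degree_between HW hi ci.
  by apply/andP; split; nra.
split.
  apply: (close _ _ _ _ _ (first _ KW) (first _ KW')).
  by rewrite osc_meanE -mulrBl -sumrB.
apply: (close _ _ _ _ _ (second _ KW) (second _ KW')).
rewrite osc_meanE -mulrBl -sumrB mulrA ler_wpM2r ?invr_ge0 ?ler0n//.
rewrite mulr_sumr big_seq [leRHS]big_seq; apply: ler_sum => i.
rewrite mem_index_iota => hi; have [? ? ?] := row_bounds hi; nra.
Qed.

(** The step function with integral [osc_mean]; unlike the number, it can be
    followed pointwise as N grows. *)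
Definition osc_step (N : nat) (p : R * R) : R :=
  \sum_(1 <= i < N.+1) \sum_(1 <= j < N.+1)
    (upper_cell W N i j - lower_cell W N i j)
      * \1_(cell R N i `*` cell R N j) p.

Lemma osc_stepE (N : nat) (p : R * R) : (0 < N)%N -> unit_square R p ->
  exists i j, [/\ (1 <= i < N.+1)%N, (1 <= j < N.+1)%N,
    (cell R N i `*` cell R N j) p &
    osc_step N p = upper_cell W N i j - lower_cell W N i j].
Proof.
move=> N0 [/= /(cell_cover N0)[i [hi ci]] /(cell_cover N0)[j [hj cj]]].
exists i, j; split => //.
exact: (cell_step2 (fun k l => upper_cell W N k l - lower_cell W N k l) hi hj).
Qed.

Lemma osc_step01 (N : nat) (p : R * R) : unit_square R p ->
  0 <= osc_step N p <= 1.
Proof.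
case: (posnP N) => [->|N0] sp; first by rewrite /osc_step big_geq// lexx ler01.
have [i [j [hi hj _ ->]]] := osc_stepE N0 sp.
by have [? ? ?] := extrema_cell hi hj; lra.
Qed.

Lemma measurable_osc_step (N : nat) :
  measurable_fun setT (osc_step N : measurableTypeR R * measurableTypeR R -> R).
Proof.
apply: measurable_sum => i; apply: measurable_sum => j.
apply: measurable_funM => //.
by apply: measurable_indic; exact: measurable_cells.
Qed.

(** At a point of continuity, W varies by at most e / 2 from W p on a ball, and
    for large N the product of cells around p is inside that ball. *)
Lemma osc_step_cvg (p : R * R) : unit_square R p ->
  W q @[q --> within (unit_square R) (nbhs p)] --> W p ->
  osc_step N p @[N --> \oo] --> (0 : R).
Proof.
move=> sp /cvgrPdist_le Wp; apply/cvgrPdist_le => e e0.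
have /nbhs_ballP[d /= d0 dW] := Wp (e / 2) (divr_gt0 e0 (ltr0Sn _ 1)).
near=> N.
have N0 : (0 < N)%N by near: N; exact: nbhs_infty_gt.
have dN : N%:R^-1 < d.
  rewrite -[ltRHS]invrK ltf_pV2 ?posrE ?invr_gt0 ?ltr0n//.
  by near: N; exact: nbhs_infty_gtr.
have [i [j [hi hj [/= ci cj] ->]]] := osc_stepE N0 sp.
have near_p q : (cell R N i `*` cell R N j) q -> `|W p - W q| <= e / 2.
  move=> cq; apply: dW; last exact: cells_square hi hj cq.
  case: cq => /= c1 c2; split; rewrite /ball/=.
    by apply: le_lt_trans dN; exact: cell_close hi _ _.
  by apply: le_lt_trans dN; exact: cell_close hj _ _.
have [_ lu _] := extrema_cell hi hj.
have Wp0 : [set W q | q in cell R N i `*` cell R N j] !=set0.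
  by exists (W p), p.
have ue : upper_cell W N i j <= W p + e / 2.
  apply: ge_sup => // _ [q /near_p + <-].
  by rewrite ler_norml => /andP[? ?]; lra.
have le : W p - e / 2 <= lower_cell W N i j.
  apply: lb_le_inf => // _ [q /near_p + <-].
  by rewrite ler_norml => /andP[? ?]; lra.
by rewrite ler_norml; apply/andP; split; lra.
Unshelve. all: by end_near. Qed.

Lemma osc_mean_integral (N : nat) :
  (\int[leb2 R]_(p in unit_square R) (osc_step N p)%:E)%E = (osc_mean W N)%:E.
Proof.
have mS := measurable_unit_square.
(* As in [Rintegral_cell], the absolute values only matter for indices that
   do not number a cell. *)
pose osc i j : R := `|upper_cell W N i j - lower_cell W N i j|.
have oscE i j : i \in index_iota 1 N.+1 -> j \in index_iota 1 N.+1 ->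
    upper_cell W N i j - lower_cell W N i j = osc i j.
  rewrite !mem_index_iota => hi hj; have [_ ? _] := extrema_cell hi hj.
  by rewrite /osc ger0_norm// subr_ge0.
have mterm i j : measurable_fun (unit_square R)
    (fun p : measurableTypeR R * measurableTypeR R =>
       (osc i j * \1_(cell R N i `*` cell R N j) p)%:E).
  apply/measurable_EFinP; apply: measurable_funM => //.
  by apply: measurable_indic; exact: measurable_cells.
have term0 i j p : (0 <= (osc i j * \1_(cell R N i `*` cell R N j) p)%:E)%E.
  by rewrite lee_fin mulr_ge0// normr_ge0.
transitivity (\int[leb2 R]_(p in unit_square R)
   (\sum_(i <- index_iota 1 N.+1) \sum_(j <- index_iota 1 N.+1)
     (osc i j * \1_(cell R N i `*` cell R N j) p)%:E))%E.
  apply: eq_integral => p _; rewrite /osc_step -sumEFin.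
  apply: eq_big_seq => i hi; rewrite -sumEFin; apply: eq_big_seq => j hj.
  by rewrite oscE.
rewrite ge0_integral_sum//=; first last.
- by move=> i p _; exact: sume_ge0.
- by move=> i; exact: (emeasurable_sum _ (mterm i)).
rewrite /osc_mean mulr_suml -sumEFin; apply: eq_big_seq => i hi.
rewrite ge0_integral_sum//; last exact: mterm.
rewrite mulr_suml -sumEFin; apply: eq_big_seq => j hj.
under eq_integral do rewrite EFinM.
rewrite ge0_integralZl_EFin//; first last.
- exact: normr_ge0.
- by apply/measurable_EFinP; apply: measurable_indic; exact: measurable_cells.
rewrite integral_indic//; last exact: measurable_cells.
rewrite !mem_index_iota in hi hj.
rewrite setIidl; last by move=> p; exact: cells_square.
rewrite [X in (_ * X)%E](lebesgue_measure_cells hi hj).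
by rewrite oscE ?mem_index_iota.
Qed.

(** Riemann's criterion, by dominated convergence. *)
Lemma osc_mean_cvg : ae_continuous_square W ->
  osc_mean W N @[N --> \oo] --> (0 : R).
Proof.
move=> Wc.
have mS := measurable_unit_square.
have leb2S : leb2 R (unit_square R) = 1%E.
  rewrite product_measure1E; [|exact: measurable_itv..].
  have leb1I : leb1 R (unit_itv R) = 1%E.
    by rewrite /unit_itv lebesgue_measure_itv/= lte_fin ltr01 -EFinB subr0.
  by rewrite [X in (X * _)%E]leb1I [X in (_ * X)%E]leb1I mule1.
have [|||||_ _] := @dominated_convergence _ _ _ (leb2 R) (unit_square R) mS
  (fun N p => (osc_step N p)%:E) (cst 0%E) (cst 1%E).
- move=> N; apply/measurable_EFinP; apply: measurable_funTS.
  exact: measurable_osc_step.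
- exact: measurable_cst.
- have [A [mA A0 WA]] := Wc; exists A; split => // p /= np; apply: WA => /= Wp.
  apply: np => sp; apply: cvg_EFin; first exact: nearW.
  exact: osc_step_cvg (Wp sp).
- apply/integrableP; split; first exact: measurable_cst.
  under eq_integral do rewrite gee0_abs ?lee01//=.
  rewrite integral_cst// [X in (_ * X)%E]leb2S mule1; exact: ltry.
- apply: aeW => p N sp; have /andP[os0 os1] := osc_step01 N sp.
  by rewrite /= lee_fin ger0_norm.
rewrite integral0 => /fine_cvg; apply: cvg_trans; apply: near_eq_cvg.
by apply: nearW => N; rewrite /= osc_mean_integral.
Qed.

End square.

(** * Convergence of the effective coupling constants *)

Lemma degree_moments_cvg (R : realType) (W : R * R -> R) :
  (forall p, unit_square R p -> 0 <= W p <= 1) -> ae_continuous_square W ->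
  (\int[leb1 R]_(y in unit_itv R) degree (step_graphon W N) y)%R
    @[N --> \oo] --> (\int[leb1 R]_(y in unit_itv R) degree W y)%R /\
  (\int[leb1 R]_(y in unit_itv R) (degree (step_graphon W N) y ^+ 2))%R
    @[N --> \oo] --> (\int[leb1 R]_(y in unit_itv R) (degree W y ^+ 2))%R.
Proof.
move=> W01 Wc; have /cvgrPdist_le osc0 := osc_mean_cvg W01 Wc.
split; apply/cvgrPdist_le => e e0; near=> N.
  have N0 : (0 < N)%N by near: N; exact: nbhs_infty_gt.
  have [+ _] := degree_moments_close W01 N0 (between_cells_self W01 (N:=N))
    (between_cells_step W01 (N:=N)).
  move=> /le_trans; apply.
  have : `|0 - osc_mean W N| <= e by near: N; exact: osc0.
  by rewrite sub0r normrN; apply: le_trans; exact: ler_norm.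
have N0 : (0 < N)%N by near: N; exact: nbhs_infty_gt.
have [_ +] := degree_moments_close W01 N0 (between_cells_self W01 (N:=N))
  (between_cells_step W01 (N:=N)).
move=> /le_trans; apply.
have : `|0 - osc_mean W N| <= e / 2.
  by near: N; apply: osc0; rewrite divr_gt0.
by rewrite sub0r normrN => /(le_trans (ler_norm _)); lra.
Unshelve. all: by end_near. Qed.

Lemma beta_eff_cvg (R : realType) (W : R * R -> R) :
  (forall p, unit_square R p -> 0 <= W p <= 1) -> ae_continuous_square W ->
  (\int[leb1 R]_(y in unit_itv R) degree W y)%R != 0 ->
  beta_eff (step_graphon W N) @[N --> \oo] --> beta_eff W.
Proof.
move=> W01 Wc W0; have [c1 c2] := degree_moments_cvg W01 Wc.
by apply: cvgM => //; exact: cvgV.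
Qed.

(** * Continuous dependence of the reduced equation *)

Section reduced_solution_regularity.
Variables (R : realType) (a b beta : R) (f : R -> R) (G : R -> R -> R).
Variable (x : R -> R).
Hypothesis x_sol : reduced_solution a b f G beta x.

(** For t > 0 the increments h with 0 <= h + t include a neighbourhood of 0, so
    the derivative is two-sided. *)
Lemma reduced_solution_is_derive (t : R) : 0 < t ->
  is_derive t 1 x (f (x t) + beta * G (x t) (x t)).
Proof.
move=> t0; have [_ dx] := x_sol (ltW t0).
have {}dx : h^-1 *: (x (h *: 1 + t) - x t) @[h --> 0^'] -->
    f (x t) + beta * G (x t) (x t).
  apply: cvg_trans dx; move=> A; rewrite /= !nbhs_filterE /= => -[e /= e0 eA].
  exists (Num.min e t) => /=; first by rewrite lt_min e0 t0.
  move=> h; rewrite /ball/= sub0r normrN lt_min => /andP[he ht] h0.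
  have := eA h; rewrite /ball/= sub0r normrN => /(_ he h0).
  have h1 : 0 <= h + t by move: ht; rewrite ltr_norml => /andP[? _]; lra.
  by move=> /(_ h1) /=; rewrite /GRing.scale/= mulr1.
apply: DeriveDef; first by apply/cvg_ex; eexists; exact: dx.
exact: cvg_lim dx.
Qed.

(** Near t, the difference quotient is bounded by |v| + 1, where v is the
    derivative at t. This also covers the one-sided case t = 0. *)
Lemma reduced_solution_continuous (T : R) : {within `[0, T], continuous x}.
Proof.
apply/subspace_continuousP => t; rewrite /= in_itv/= => /andP[t0 _].
have [_ /cvgrPdist_le dx] := x_sol t0.
set v := f (x t) + _ in dx.
have /= [e /= e0 eA] := dx 1 ltr01.
apply/cvgrPdist_le => eps eps0; apply/nbhs_ballP.
have v1 : 0 < `|v| + 1 by rewrite ltr_wpDl.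
exists (Num.min e (eps / (`|v| + 1))) => /=.
  by rewrite lt_min e0 divr_gt0.
move=> s; rewrite /ball/= lt_min => /andP[se sd].
rewrite in_itv/= => /andP[s0 _].
have [->|st] := eqVneq s t; first by rewrite subrr normr0 ltW.
have st0 : s - t != 0 by rewrite subr_eq0.
have := eA (s - t); rewrite /ball/= sub0r normrN distrC => /(_ se st0).
rewrite subrK => /(_ s0) H.
have {}H : `|(s - t)^-1 * (x s - x t)| <= `|v| + 1.
  rewrite -[X in `|X|](subrK v) addrC (le_trans (ler_normD _ _))// lerD2l.
  by rewrite distrC.
move: H; rewrite normrM normfV ler_pdivrMl ?normr_gt0// => H.
rewrite distrC (le_trans H)// -ler_pdivlMr// distrC; exact: ltW.
Qed.

End reduced_solution_regularity.

(** The function (v + c) exp (- L t) is nonincreasing: as 1 <= L, the hypothesis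
    on v' gives (v + c)' <= L (v + c). *)
Lemma gronwall (R : realType) (v v' : R -> R) (L c T : R) :
  1 <= L -> 0 <= c -> {within `[0, T], continuous v} ->
  (forall t, 0 < t < T -> is_derive t 1 v (v' t) /\ v' t <= L * v t + c) ->
  forall t, 0 <= t <= T -> v t + c <= (v 0 + c) * expR (L * t).
Proof.
move=> L1 c0 vc vd t /andP[t0 tT].
pose w s := (v s + c) * expR (- L * s).
have wd s : 0 < s < T ->
    is_derive s 1 w ((v' s - L * (v s + c)) * expR (- L * s)).
  move=> /vd[dv _].
  have dvc := is_deriveD dv (is_derive_cst c s 1).
  have dL := is_deriveZ (- L) (is_derive_id s 1).
  have dE := is_derive1_comp (is_derive_expR _) dL.
  apply: (is_derive_eq (is_deriveM dvc dE)).
  change ((v s + c) * (expR (- L * s) * (- L * 1)) + expR (- L * s) * (v' s + 0)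
    = (v' s - L * (v s + c)) * expR (- L * s)).
  by ring.
have wc : {within `[0, T], continuous w}.
  move=> s; apply: cvgM; first by apply: cvgD; [exact: vc|exact: cvg_cst].
  apply: continuous_subspaceT => {}s.
  apply: continuous_comp; last exact: continuous_expR.
  by apply: cvgM; [exact: cvg_cst|exact: cvg_id].
have : w t <= w 0.
  apply: (ler0_derive1_le_cc _ _ wc) => //; rewrite ?in_itv/= ?t0 ?lexx//.
  - by move=> s; rewrite in_itv/= => /wd[].
  - move=> s; rewrite in_itv/= => hs; have [_ dle] := vd _ hs.
    have [_ dw] := wd _ hs; rewrite derive1E dw pmulr_lle0 ?expR_gt0//.
    by nra.
  - exact: le_trans t0 tT.
rewrite /w mulr0 expR0 mulr1 mulNr expRN => h.
by rewrite -ler_pdivrMr ?expR_gt0.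
Qed.

(** Gronwall's inequality for u ^ 2, where u is the difference of the solutions.
    The function f + beta * G has the Lipschitz constant
    K = |L_f| + |beta| |L_G| sqrt 2 on the diagonal, and the factor of
    |beta' - beta| bounds G there; for d the product of these two factors,
    (u ^ 2)' <= 2 |u| (K |u| + d) <= (2 K + 1) u ^ 2 + d ^ 2. *)
Lemma reduced_solution_close (R : realType) (a b L_f L_G : R) (f : R -> R)
    (G : R -> R -> R) (beta beta' : R) (x x' : R -> R) (T : R) :
  lipschitz1 a b L_f f -> lipschitz2 a b L_G G ->
  reduced_solution a b f G beta x -> reduced_solution a b f G beta' x' ->
  forall t, t \in `[0, T] ->
    `|x' t - x t| <=
      (`|x' 0 - x 0| + `|beta' - beta|
         * (`|G a a| + `|L_G| * Num.sqrt 2 * (b - a)))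
      * expR ((2 * (`|L_f| + `|beta| * (`|L_G| * Num.sqrt 2)) + 1) * T).
Proof.
move=> fL GL xs xs' t; rewrite in_itv/= => tT.
set K' := `|L_G| * Num.sqrt 2; set K := `|L_f| + `|beta| * K'.
set M := `|G a a| + K' * (b - a); set d := `|beta' - beta| * M.
(* The Lipschitz constants may be negative when a = b, hence their absolute
   values. *)
have fE u v : u \in `[a, b] -> v \in `[a, b] ->
    `|f u - f v| <= `|L_f| * `|u - v|.
  move=> hu hv; apply: (le_trans (fL _ _ hu hv)).
  by rewrite ler_wpM2r// ler_norm.
have GE u v : u \in `[a, b] -> v \in `[a, b] ->
    `|G u u - G v v| <= K' * `|u - v|.
  move=> hu hv; apply: (le_trans (GL _ _ _ _ hu hu hv hv)).
  rewrite -mulr2n -[_ *+ 2]mulr_natl sqrtrM// sqrtr_sqr /K' mulrA.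
  by rewrite !ler_wpM2r// ?sqrtr_ge0// ler_norm.
have K'0 : 0 <= K' by rewrite mulr_ge0// sqrtr_ge0.
have K0 : 0 <= K by rewrite addr_ge0// mulr_ge0.
have xab s : 0 <= s -> x s \in `[a, b] by move=> /xs[].
have xab' s : 0 <= s -> x' s \in `[a, b] by move=> /xs'[].
have GM u : u \in `[a, b] -> `|G u u| <= M.
  move=> hu; have /andP[au ub] : a <= u <= b by rewrite in_itv in hu.
  have ha : a \in `[a, b] by rewrite in_itv/= lexx (le_trans au).
  rewrite -(subrK (G a a) (G u u)) (le_trans (ler_normD _ _))// /M addrC lerD2l.
  apply: (le_trans (GE _ _ hu ha)); rewrite ler_wpM2l// ger0_norm ?subr_ge0//.
  by rewrite lerD2r.
have M0 : 0 <= M by exact: le_trans (normr_ge0 _) (GM _ (xab 0 (lexx 0))).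
have d0 : 0 <= d by rewrite mulr_ge0.
pose u s := x' s - x s.
pose u' s := f (x' s) + beta' * G (x' s) (x' s)
  - (f (x s) + beta * G (x s) (x s)).
have u'E s : 0 <= s -> `|u' s| <= K * `|u s| + d.
  move=> s0.
  have -> : u' s = (f (x' s) - f (x s))
      + beta * (G (x' s) (x' s) - G (x s) (x s))
      + (beta' - beta) * G (x' s) (x' s) by rewrite /u'; ring.
  apply: (le_trans (ler_normD _ _)); apply: lerD; last first.
    by rewrite normrM ler_wpM2l// GM// xab'.
  apply: (le_trans (ler_normD _ _)); rewrite /K mulrDl; apply: lerD.
    by apply: fE; [exact: xab'|exact: xab].
  by rewrite normrM -mulrA ler_wpM2l//; apply: GE; [exact: xab'|exact: xab].
have uc : {within `[0, T], continuous (fun s => u s * u s)}.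
  have uc1 : {within `[0, T], continuous u}.
    move=> s; apply: cvgB; first exact: reduced_solution_continuous xs' _ _.
    exact: reduced_solution_continuous xs _ _.
  by move=> s; apply: cvgM; exact: uc1.
have L1 : 1 <= 2 * K + 1 by lra.
have := gronwall (v' := fun s => 2 * u s * u' s) L1 (sqr_ge0 d) uc _ tT.
have ud s : 0 < s < T -> is_derive s 1 (fun s => u s * u s) (2 * u s * u' s) /\
    2 * u s * u' s <= (2 * K + 1) * (u s * u s) + d ^+ 2.
  move=> /andP[s0 _]; split.
    have du := is_deriveB (reduced_solution_is_derive xs' s0)
      (reduced_solution_is_derive xs s0).
    apply: (is_derive_eq (is_deriveM du du)).
    by change (u s * u' s + u s * u' s = 2 * u s * u' s); ring.
  have := u'E s (ltW s0).
  have uu : u s * u s = `|u s| * `|u s|.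
    by rewrite -normrM ger0_norm// -expr2 sqr_ge0.
  move=> /(ler_wpM2l (normr_ge0 (u s))) hu'.
  have := ler_norm (u s * u' s); rewrite normrM uu => hu.
  by have := sqr_ge0 (`|u s| - d); rewrite sqrrB; lra.
move=> /(_ ud) H.
set E := expR _.
have E1 : 1 <= E.
  rewrite -expR0 ler_expR mulr_ge0//; first lra.
  by move: tT => /andP[]; exact: le_trans.
have tE : expR ((2 * K + 1) * t) <= E.
  by rewrite ler_expR ler_wpM2l//; [lra|move: tT => /andP[]].
(* Since 1 <= E, bounding E by E ^ 2 makes the bound a square. *)
have {}H : `|u t| ^+ 2 <= ((`|u 0| + d) * E) ^+ 2.
  rewrite real_normK ?num_real//.
  have u0 : u 0 * u 0 = `|u 0| ^+ 2 by rewrite real_normK ?num_real.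
  rewrite u0 in H; have n0 := normr_ge0 (u 0).
  have s1 : `|u 0| ^+ 2 + d ^+ 2 <= (`|u 0| + d) ^+ 2 by nra.
  apply: (@le_trans _ _ (u t * u t + d ^+ 2)).
    by rewrite expr2 lerDl sqr_ge0.
  apply: (le_trans H); rewrite [leRHS]exprMn; apply: ler_pM => //.
  - by apply: addr_ge0; exact: sqr_ge0.
  - by rewrite (le_trans tE)// expr2 ler_peMr// (le_trans ler01).
move: H; rewrite ler_pXn2r// nnegrE ?normr_ge0//.
by rewrite mulr_ge0 ?addr_ge0// expR_ge0.
Qed.

Lemma within_continuous_norm_max (R : realType) (u : R -> R) (T : R) :
  0 <= T -> {within `[0, T], continuous u} ->
  exists m, is_maximum [set `|u t| | t in `[0, T]] m.
Proof.
move=> T0 uc.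
have nc : {within `[0, T], continuous (fun t => `|u t|)}.
  by move=> s; apply: cvg_norm; exact: uc.
have [c cT cmax] := EVT_max T0 nc; exists `|u c|; split; first by exists c.
by move=> _ [t tT <-]; exact: cmax.
Qed.

Theorem lemma2 (R : realType) (W : R * R -> R)
    (W_graphon : graphon W) (W_ae_cont : ae_continuous_square W)
    (W_pos : 0 < (\int[leb1 R]_(y' in unit_itv R)
                    (\int[leb1 R]_(y in unit_itv R) W (y, y'))%R)%R)
    (a b L_f L_G : R) (a_le_b : a <= b) (f : R -> R) (G : R -> R -> R)
    (f_lip : lipschitz1 a b L_f f) (G_lip : lipschitz2 a b L_G G)
    (xN : nat -> R -> R) (x : R -> R)
    (xN_sol : forall N : nat, (0 < N)%N ->
       reduced_solution a b f G (beta_eff (step_graphon W N)) (xN N))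
    (x_sol : reduced_solution a b f G (beta_eff W) x)
    (init : `|xN N 0 - x 0| @[N --> \oo] --> (0 : R)) (T : R) (T_gt0 : 0 < T) :
  exists m : nat -> R,
    (forall N : nat, (0 < N)%N ->
       is_maximum [set `|xN N t - x t| | t in `[0, T]] (m N)) /\
    m N @[N --> \oo] --> (0 : R).
Proof.
have [W_sym _ W01] := W_graphon.
have W0 : (\int[leb1 R]_(y in unit_itv R) degree W y)%R != 0.
  rewrite gt_eqF//; move: W_pos; congr (0 < _).
  apply: eq_Rintegral => y' /set_mem Iy'; apply: eq_Rintegral => y /set_mem Iy.
  exact: W_sym.
have beta_cvg := beta_eff_cvg W01 W_ae_cont W0.
have max_ex N : exists m, (0 < N)%N ->
    is_maximum [set `|xN N t - x t| | t in `[0, T]] m.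
  have [->|N0] := posnP N; first by exists 0.
  have dc : {within `[0, T], continuous (fun t => xN N t - x t)}.
    move=> t; apply: cvgB.
      exact: reduced_solution_continuous (xN_sol _ N0) _ _.
    exact: reduced_solution_continuous x_sol _ _.
  by have [m mP] := within_continuous_norm_max (ltW T_gt0) dc; exists m.
have [m mP] := choice max_ex; exists m; split => //.
pose M := `|G a a| + `|L_G| * Num.sqrt 2 * (b - a).
pose E := expR ((2 * (`|L_f| + `|beta_eff W| * (`|L_G| * Num.sqrt 2)) + 1) * T).
apply: (@squeeze_cvgr _ _ _ _ (cst 0) (fun N => (`|xN N 0 - x 0| +
    `|beta_eff (step_graphon W N) - beta_eff W| * M) * E)).
- near=> N.
  have N0 : (0 < N)%N by near: N; exact: nbhs_infty_gt.
  have [[t tT <-] _] := mP _ N0; rewrite normr_ge0/=.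
  exact: reduced_solution_close f_lip G_lip x_sol (xN_sol _ N0) _ tT.
- exact: cvg_cst.
- rewrite -[X in _ --> X](mul0r E); apply: cvgM; last exact: cvg_cst.
  rewrite -[X in _ --> X]addr0; apply: cvgD => //.
  rewrite -[X in _ --> X](mul0r M); apply: cvgM; last exact: cvg_cst.
  rewrite -(normr0 R) -(subrr (beta_eff W)); apply: cvg_norm.
  by apply: cvgB => //; exact: cvg_cst.
Unshelve. all: by end_near. Qed.
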